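(* For a semidomain $S$, the following statements are equivalent: (1) $S$ is a Dedekind semidomain. (2) $S$ is Noetherian and for each maximal ideal $\mathfrak{m}$ of $S$, the localization $S_{\mathfrak{m}}$ is a discrete valuation semiring.
   Context: A semiring is $(S,+,\cdot,0,1)$ where $(S,+,0)$ and $(S,\cdot,1)$ are commutative monoids, $1\neq 0$, multiplication distributes over addition, and $a\cdot 0=0$ for all $a$. A semidomain is a semiring $S$ in which $ab=ac$ with $a\neq 0$ implies $b=c$. Its semifield of fractions $K=F(S)$ is the localization of $S$ at $S-\{0\}$. For a prime ideal $\mathfrak{p}$, $S_{\mathfrak{p}}$ is the localization of $S$ at the multiplicatively closed set $S-\mathfrak{p}$. An ideal of $S$ is a nonempty subset closed under addition and under multiplication by elements of $S$; it is proper if it is not $S$. $S$ is Noetherian if each ideal of $S$ is finitely generated. A fractional ideal of $S$ is a nonempty subset $A\subseteq K$ closed under addition and under multiplication by elements of $S$ such that $dA\subseteq S$ for some nonzero $d\in S$. The product of fractional ideals $A,B$ is $AB=\{\sum_{i=1}^n a_ib_i: a_i\in A, b_i\in B\}$, and $A$ is invertible if $AB=S$ for some fractional ideal $B$. A Dedekind semidomain is a semidomain in which each nonzero fractional ideal is invertible. A principal ideal semidomain (PISD) is a semidomain in which each ideal is principal (generated by a single element). A discrete valuation semiring (DVS) is a PISD possessing a unique maximal ideal. *)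

(* Defs.v *)
From HB Require Import structures.
From mathcomp Require Import all_boot all_algebra.
From mathcomp Require Import generic_quotient.
From mathcomp Require Import boolp classical_sets cardinality.
From mathcomp Require Import ring.

Set Implicit Arguments.
Unset Strict Implicit.
Unset Printing Implicit Defensive.

Import GRing.Theory.
Local Open Scope classical_set_scope.
Local Open Scope ring_scope.
Local Open Scope quotient_scope.

HB.mixin Record ComNzSemiRing_isSemidomain S of GRing.ComNzSemiRing S := {
  sd_mulfI : forall a b c : S, a != 0 -> a * b = a * c -> b = c
}.

#[short(type="semidomainType")]
HB.structure Definition Semidomain :=
  {S of GRing.ComNzSemiRing S & ComNzSemiRing_isSemidomain S}.

Lemma sd_mulf_neq0 (S : semidomainType) (a b : S) :
  a != 0 -> b != 0 -> a * b != 0.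
Proof.
move=> a0; apply: contra_neq => ab0.
by apply: (@sd_mulfI S a); rewrite // ab0 mulr0.
Qed.

Section Ideals.
Variable S : comNzSemiRingType.
Implicit Types I J : set S.

Definition is_ideal I : Prop :=
  [/\ I !=set0,
      forall a b, I a -> I b -> I (a + b) &
      forall s a, I a -> I (s * a)].

Definition ideal_gen (G : set S) : set S := smallest is_ideal G.

Definition finitely_generated I : Prop :=
  exists2 G : set S, finite_set G & I = ideal_gen G.

Definition principal I : Prop := exists a : S, I = ideal_gen [set a].

Definition noetherian : Prop :=
  forall I, is_ideal I -> finitely_generated I.

Definition is_proper_ideal I : Prop := is_ideal I /\ I <> setT.

Definition is_maximal_ideal I : Prop :=
  is_proper_ideal I /\ forall J, is_proper_ideal J -> I `<=` J -> J = I.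

Definition is_prime_ideal I : Prop :=
  is_proper_ideal I /\ forall a b, I (a * b) -> I a \/ I b.

Lemma ideal0 I : is_ideal I -> I 0.
Proof. by case=> -[a Ia] _ IM; rewrite -(mul0r a); exact: IM. Qed.

Lemma proper_ideal1 I : is_proper_ideal I -> ~ I 1.
Proof.
move=> [[_ _ IM] IT] I1; apply: IT; apply/seteqP; split=> // x _.
by rewrite -(mulr1 x); exact: IM.
Qed.

Lemma maximal_ideal_prime I : is_maximal_ideal I -> is_prime_ideal I.
Proof.
move=> [pI maxI]; split=> // a b Iab.
have [idI _] := pI; have [_ ID IM] := idI.
apply: contrapT => /not_orP[nIa nIb].
pose J := [set x | exists y r, I y /\ x = y + r * a].
have idJ : is_ideal J.
  split.
  - by exists (0 + 0 * a); exists 0, 0; split => //; exact: ideal0.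
  - move=> _ _ [y [r [Iy ->]]] [z [t [Iz ->]]].
    exists (y + z), (r + t); split; first exact: ID.
    by rewrite mulrDl addrACA.
  - move=> s _ [y [r [Iy ->]]]; exists (s * y), (s * r); split; first exact: IM.
    by rewrite mulrDr mulrA.
have JI : I `<=` J.
  by move=> x Ix; exists x, 0; rewrite mul0r addr0.
have Ja : J a.
  by exists 0, 1; rewrite mul1r add0r; split => //; exact: ideal0.
have JT : J = setT.
  apply: contrapT => nJT; apply: nIa.
  by rewrite -(maxI J) //; split.
have [y [r [Iy e1]]] : J 1 by rewrite JT.
apply: nIb; rewrite -(mul1r b) e1 mulrDl -mulrA; apply: ID; last exact: IM.
by rewrite mulrC; exact: IM.
Qed.

End Ideals.

(* Multiplicatively closed sets are required to omit 0, so that the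
   localization below satisfies 1 != 0. *)
Record multSet (S : comNzSemiRingType) := MultSet {
  mset : set S;
  mset1 : mset 1;
  msetM : forall a b, mset a -> mset b -> mset (a * b);
  mset0 : ~ mset 0 }.

Section Localization.
Variables (S : comNzSemiRingType) (T : multSet S).

Definition prefrac : Type := S * set_type (mset T).
HB.instance Definition _ := Choice.on prefrac.

Implicit Types x y z : prefrac.

Definition den x : S := val x.2.

Lemma denP x : mset T (den x).
Proof. exact: set_mem (valP x.2). Qed.

Definition mkfrac (a s : S) (Ts : mset T s) : prefrac := (a, exist _ s (mem_set Ts)).

Definition loc_eq x y : Prop :=
  exists2 u : S, mset T u & u * (x.1 * den y) = u * (y.1 * den x).

Definition loc_rel x y : bool := `[< loc_eq x y >].

Lemma loc_rel_refl : reflexive loc_rel.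
Proof. by move=> x; apply/asboolP; exists 1; first exact: mset1. Qed.

Lemma loc_rel_sym : symmetric loc_rel.
Proof. by move=> x y; apply/asboolP/asboolP => -[u Tu e]; exists u. Qed.

Lemma loc_rel_trans : transitive loc_rel.
Proof.
move=> y x z /asboolP[u Tu exy] /asboolP[v Tv eyz]; apply/asboolP.
exists (u * v * den y); first by do 2?apply: msetM => //; exact: denP.
transitivity (v * den z * (u * (x.1 * den y))); first by ring.
rewrite exy; transitivity (u * den x * (v * (y.1 * den z))); first by ring.
by rewrite eyz; ring.
Qed.

Canonical loc_equiv := EquivRel loc_rel loc_rel_refl loc_rel_sym loc_rel_trans.

Definition localization : Type := {eq_quot loc_equiv}.

HB.instance Definition _ := Choice.on localization.
HB.instance Definition _ := EqQuotient.on localization.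

Definition fracc (a s : S) (Ts : mset T s) : localization := \pi_localization (mkfrac a Ts).

Lemma loc_piP x y : reflect (loc_eq x y) (\pi_localization x == \pi_localization y).
Proof. by rewrite eqmodE; exact: asboolP. Qed.

Lemma pi_loc_eq x y : loc_eq x y -> \pi_localization x = \pi_localization y.
Proof. by move=> h; apply/eqP/loc_piP. Qed.

Lemma repr_loc_eq x : loc_eq (repr (\pi_localization x)) x.
Proof. by apply/loc_piP; rewrite reprK. Qed.

Definition addlf x y : prefrac :=
  mkfrac (x.1 * den y + y.1 * den x) (msetM (denP x) (denP y)).
Definition mullf x y : prefrac :=
  mkfrac (x.1 * y.1) (msetM (denP x) (denP y)).

Lemma den_mkfrac a s (Ts : mset T s) : den (mkfrac a Ts) = s.
Proof. by []. Qed.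
Lemma num_mkfrac a s (Ts : mset T s) : (mkfrac a Ts).1 = a.
Proof. by []. Qed.
Lemma den_addlf x y : den (addlf x y) = den x * den y.
Proof. by []. Qed.
Lemma num_addlf x y : (addlf x y).1 = x.1 * den y + y.1 * den x.
Proof. by []. Qed.
Lemma den_mullf x y : den (mullf x y) = den x * den y.
Proof. by []. Qed.
Lemma num_mullf x y : (mullf x y).1 = x.1 * y.1.
Proof. by []. Qed.
Definition locfracE :=
  (num_addlf, den_addlf, num_mullf, den_mullf, num_mkfrac, den_mkfrac).

Definition loc_zero : localization := fracc 0 (mset1 T).
Definition loc_one : localization := fracc 1 (mset1 T).
Definition loc_add (p q : localization) : localization :=
  \pi_localization (addlf (repr p) (repr q)).
Definition loc_mul (p q : localization) : localization :=
  \pi_localization (mullf (repr p) (repr q)).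

Lemma pi_addlf x y : loc_add (\pi_localization x) (\pi_localization y) = \pi_localization (addlf x y).
Proof.
apply: pi_loc_eq; move: (repr_loc_eq x) (repr_loc_eq y).
set x' := repr _; set y' := repr _ => -[u Tu ex] [v Tv ey].
exists (u * v); first exact: msetM.
rewrite ?locfracE.
transitivity (u * (x'.1 * den x) * (v * den y' * den y)
            + v * (y'.1 * den y) * (u * den x' * den x)); first by ring.
by rewrite ex ey; ring.
Qed.

Lemma pi_mullf x y : loc_mul (\pi_localization x) (\pi_localization y) = \pi_localization (mullf x y).
Proof.
apply: pi_loc_eq; move: (repr_loc_eq x) (repr_loc_eq y).
set x' := repr _; set y' := repr _ => -[u Tu ex] [v Tv ey].
exists (u * v); first exact: msetM.
rewrite ?locfracE.
transitivity (u * (x'.1 * den x) * (v * (y'.1 * den y))); first by ring.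
by rewrite ex ey; ring.
Qed.

Lemma pi_loc_eq1 x y : x.1 * den y = y.1 * den x -> \pi_localization x = \pi_localization y.
Proof. by move=> e; apply: pi_loc_eq; exists 1; [exact: mset1|rewrite e]. Qed.

Lemma loc_addA : associative loc_add.
Proof.
elim/quotW=> x; elim/quotW=> y; elim/quotW=> z; rewrite (pi_addlf y z) (pi_addlf x y) (pi_addlf x) pi_addlf.
by apply: pi_loc_eq1; rewrite ?locfracE; ring.
Qed.

Lemma loc_addC : commutative loc_add.
Proof.
elim/quotW=> x; elim/quotW=> y; rewrite (pi_addlf x y) (pi_addlf y x).
by apply: pi_loc_eq1; rewrite ?locfracE; ring.
Qed.

Lemma loc_add0 : left_id loc_zero loc_add.
Proof.
elim/quotW=> x; rewrite pi_addlf.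
by apply: pi_loc_eq1; rewrite ?locfracE; ring.
Qed.

HB.instance Definition _ :=
  GRing.isNmodule.Build localization loc_addA loc_addC loc_add0.

Lemma loc_mulA : associative loc_mul.
Proof.
elim/quotW=> x; elim/quotW=> y; elim/quotW=> z; rewrite (pi_mullf y z) (pi_mullf x y) (pi_mullf x) pi_mullf.
by apply: pi_loc_eq1; rewrite ?locfracE; ring.
Qed.

Lemma loc_mulC : commutative loc_mul.
Proof.
elim/quotW=> x; elim/quotW=> y; rewrite (pi_mullf x y) (pi_mullf y x).
by apply: pi_loc_eq1; rewrite ?locfracE; ring.
Qed.

Lemma loc_mul1 : left_id loc_one loc_mul.
Proof.
elim/quotW=> x; rewrite pi_mullf.
by apply: pi_loc_eq1; rewrite ?locfracE; ring.
Qed.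

Lemma loc_mulDl : left_distributive loc_mul loc_add.
Proof.
elim/quotW=> x; elim/quotW=> y; elim/quotW=> z.
rewrite (pi_addlf x y) (pi_mullf (addlf x y)) (pi_mullf x z) (pi_mullf y z) pi_addlf.
by apply: pi_loc_eq1; rewrite ?locfracE; ring.
Qed.

Lemma loc_mul0 : left_zero loc_zero loc_mul.
Proof.
elim/quotW=> x; rewrite pi_mullf.
by apply: pi_loc_eq1; rewrite ?locfracE; ring.
Qed.

Lemma loc_1neq0 : loc_one != loc_zero.
Proof.
apply/loc_piP => -[u Tu]; rewrite !locfracE mul0r mulr0 !mulr1 => u0.
by apply: (@mset0 S T); rewrite -u0.
Qed.

HB.instance Definition _ := GRing.Nmodule_isComNzSemiRing.Build localization
  loc_mulA loc_mulC loc_mul1 loc_mulDl loc_mul0 loc_1neq0.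

Definition loc_map (a : S) : localization := fracc a (mset1 T).

End Localization.

Section SemidomainLocalization.
Variables (S : semidomainType) (T : multSet S).

Lemma mset_neq0 (s : S) : mset T s -> s != 0.
Proof. by apply: contraPneq => ->; exact: mset0. Qed.

Lemma loc_mulfI (p q r : localization T) : p != 0 -> p * q = p * r -> q = r.
Proof.
elim/quotW: p => x; elim/quotW: q => y; elim/quotW: r => z x0.
have x10 : x.1 != 0.
  apply: contra_neq x0 => x10; apply: pi_loc_eq1.
  by rewrite x10 /= !mul0r.
move=> e; have : loc_mul (\pi_(localization T) x) (\pi_(localization T) y) = loc_mul (\pi_(localization T) x) (\pi_(localization T) z) by [].
rewrite (pi_mullf x y) (pi_mullf x z) => /eqP/loc_piP[u Tu]; rewrite !locfracE => e'.
apply: pi_loc_eq1.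
have n0 : u * (x.1 * den x) != 0.
  by rewrite !sd_mulf_neq0 // mset_neq0 //; exact: denP.
apply: (@sd_mulfI S _ _ _ n0).
transitivity (u * (x.1 * y.1 * (den x * den z))); first by ring.
by rewrite e'; ring.
Qed.

HB.instance Definition _ :=
  ComNzSemiRing_isSemidomain.Build (localization T) loc_mulfI.

End SemidomainLocalization.

Section PrimeLocalization.
Variables (S : comNzSemiRingType) (p : set S) (pp : is_prime_ideal p).

Lemma primeC1 : (~` p) 1.
Proof. by case: pp => /proper_ideal1. Qed.

Lemma primeCM a b : (~` p) a -> (~` p) b -> (~` p) (a * b).
Proof. by move=> na nb /pp.2[]. Qed.

Lemma primeC0 : ~ (~` p) 0.
Proof. by apply; apply: ideal0; case: pp => -[]. Qed.

Definition prime_compl : multSet S := MultSet primeC1 primeCM primeC0.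

End PrimeLocalization.

Definition localization_at (S : semidomainType) (p : set S)
  (pp : is_prime_ideal p) : semidomainType := localization (prime_compl pp).

Section FractionSemifield.
Variable S : semidomainType.

Lemma nonzero1 : (~` [set 0]) (1 : S).
Proof. by apply/eqP; exact: oner_neq0. Qed.

Lemma nonzeroM (a b : S) :
  (~` [set 0]) a -> (~` [set 0]) b -> (~` [set 0]) (a * b).
Proof. by move=> /eqP a0 /eqP b0; apply/eqP; exact: sd_mulf_neq0. Qed.

Lemma nonzero0 : ~ (~` [set 0]) (0 : S).
Proof. by apply. Qed.

Definition nonzero_mset : multSet S := MultSet nonzero1 nonzeroM nonzero0.

Definition semifield_of_fractions : semidomainType := localization nonzero_mset.
Local Notation K := semifield_of_fractions.

Definition to_frac (a : S) : K := loc_map nonzero_mset a.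

Definition fractional_ideal (A : set K) : Prop :=
  [/\ A !=set0,
      forall x y, A x -> A y -> A (x + y),
      forall s x, A x -> A (to_frac s * x) &
      exists2 d : S, d != 0 & forall x, A x -> range to_frac (to_frac d * x)].

(* The empty sum (n = 0) adds nothing: fractional ideals contain 0. *)
Definition frac_mul (A B : set K) : set K :=
  [set x | exists n (a b : 'I_n -> K),
     [/\ forall i, A (a i), forall i, B (b i) & x = \sum_(i < n) a i * b i]].

Definition frac_invertible (A : set K) : Prop :=
  exists2 B : set K, fractional_ideal B & frac_mul A B = range to_frac.

Definition dedekind : Prop :=
  forall A : set K, fractional_ideal A -> A <> [set 0] -> frac_invertible A.

End FractionSemifield.

Definition pisd (S : semidomainType) : Prop :=
  forall I : set S, is_ideal I -> principal I.

(* Not being a semifield is not required: a semifield, whose only maximal ideal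
   is {0}, is a discrete valuation semiring in this sense. *)
Definition dvs (S : semidomainType) : Prop :=
  pisd S /\ exists! m : set S, is_maximal_ideal m.

Arguments noetherian : clear implicits.
Arguments dedekind : clear implicits.

(* Main.v *)
(* Both directions rest on 1 lying in the product of an ideal with its inverse.
   If 1 = sum a_i b_i with a_i in I and b_i in its inverse, then x = sum a_i (x b_i)
   shows that the a_i generate I; moreover some s_i = a_i b_i lies outside a given
   maximal ideal m, and s_i x = (x b_i) a_i makes I principal at m.  Conversely, if A
   is finitely generated and locally principal, then A A^-1 lies in no maximal ideal,
   so it is S. *)
Require Import Defs.
From mathcomp Require Import all_boot all_algebra classical_sets.
From mathcomp Require Import boolp cardinality ring.

Set Implicit Arguments.
Unset Strict Implicit.
Unset Printing Implicit Defensive.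

Import GRing.Theory.
Local Open Scope classical_set_scope.
Local Open Scope ring_scope.

(** * Generated ideals, and maximal ideals above a proper ideal *)

Section IdealTheory.
Variable S : comNzSemiRingType.
Implicit Types I J G : set S.

Lemma principal_ideal (a : S) : is_ideal [set x : S | exists r, x = r * a].
Proof.
split; first by exists (0 * a), 0.
- by move=> _ _ [r ->] [t ->]; exists (r + t); rewrite mulrDl.
- by move=> s _ [r ->]; exists (s * r); rewrite mulrA.
Qed.

Lemma principal_gen I a : is_ideal I -> I a ->
  (forall x, I x -> exists r, x = r * a) -> I = ideal_gen [set a].
Proof.
move=> hI Ia Ir; apply/seteqP; split=> x.
  by move=> /Ir[r ->] J [[_ _ hM] aJ]; apply: hM; exact: aJ.
by apply; split=> // _ ->.
Qed.

Lemma ideal_gen1P (a x : S) : ideal_gen [set a] x -> exists r, x = r * a.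
Proof.
move=> /(_ [set x | exists r, x = r * a]); apply; split.
  exact: principal_ideal.
by move=> _ ->; exists 1; rewrite mul1r.
Qed.

Lemma ideal_sum I n (F : 'I_n -> S) :
  is_ideal I -> (forall i, I (F i)) -> I (\sum_(i < n) F i).
Proof.
move=> hI IF; elim/big_ind: _ => //; first exact: ideal0.
by case: hI.
Qed.

Lemma maximal_ideal_above I : is_proper_ideal I ->
  exists2 m, is_maximal_ideal m & I `<=` m.
Proof.
move=> pI.
(* Joining [I] to each set lets the empty chain satisfy the hypothesis of Zorn's lemma: its union is
   empty, and [I] itself is proper. *)
pose P (X : set S) := is_proper_ideal (X `|` I).
have [F FP Ftot|A [PA maxA]] := @Zorn_bigcup S P.
  have [idI _] := pI; have [_ ID IM] := idI.
  have mono X a : F X -> (X `|` I) a -> ((\bigcup_(X in F) X) `|` I) a.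
    by move=> FX [Xa|Ia]; [left; exists X|right].
  split; first split.
  - by exists 0; right; exact: ideal0.
  - move=> a b [[X FX Xa]|Ia] [[Y FY Yb]|Ib].
    + have [XY|YX] := Ftot _ _ FX FY.
        have [[_ YD _] _] := FP _ FY.
        by apply: (mono Y) => //; apply: YD; left => //; exact: XY.
      have [[_ XD _] _] := FP _ FX.
      by apply: (mono X) => //; apply: XD; left => //; exact: YX.
    + have [[_ XD _] _] := FP _ FX.
      by apply: (mono X) => //; apply: XD; [left|right].
    + have [[_ YD _] _] := FP _ FY.
      by apply: (mono Y) => //; apply: YD; [right|left].
    + by right; exact: ID.
  - move=> s a [[X FX Xa]|Ia]; last by right; exact: IM.
    have [[_ _ XM] _] := FP _ FX.
    by apply: (mono X) => //; apply: XM; left.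
  - move=> UT; have : ((\bigcup_(X in F) X) `|` I) 1 by rewrite UT.
    case=> [[X FX X1]|]; last exact: proper_ideal1.
    by apply: (proper_ideal1 (FP _ FX)); left.
exists (A `|` I); last by move=> x Ix; right.
split=> // J pJ AIJ.
have JI : J `|` I = J by apply/setUidPl => x Ix; apply: AIJ; right.
have AJ : A `<=` J by move=> x Ax; apply: AIJ; left.
suff -> : A = J by rewrite JI.
apply: contrapT => nAJ; apply: (maxA J); last by rewrite /P JI.
by split=> // JA; apply: nAJ; apply/seteqP.
Qed.

(* Finite generation turns one multiplier per generator into a common one. *)
Lemma common_multiplier (T : multSet S) I G : is_ideal I -> finite_set G ->
  (forall g, G g -> exists2 t, mset T t & I (t * g)) ->
  exists2 t, mset T t & ideal_gen G `<=` [set x | I (t * x)].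
Proof.
move=> hI /finite_seqP[s ->] sT; have [_ ID IM] := hI.
(* The [x] with [t * x] in [I] form an ideal, so it is enough to test the generators; the induction
   then multiplies their multipliers together. *)
suff [t Tt tI] : exists2 t, mset T t & forall g, g \in s -> I (t * g).
  exists t => // x; apply; split=> // {x}; split.
  - by exists 0; rewrite /= mulr0; exact: ideal0.
  - by move=> a b /= Ia Ib; rewrite mulrDr; exact: ID.
  - by move=> r a /= Ia; rewrite mulrCA; exact: IM.
elim: s sT => [|g s IH] sT; first by exists 1 => //; exact: mset1.
have [g' gs|t Tt tI] := IH; first by apply: sT; rewrite /= inE gs orbT.
have [u Tu uI] : exists2 u, mset T u & I (u * g).
  by apply: sT; rewrite /= mem_head.
exists (u * t); first exact: msetM.
move=> g'; rewrite inE => /orP[/eqP->|/tI]; last by rewrite -mulrA; exact: IM.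
by rewrite (mulrC u) -mulrA; exact: IM.
Qed.

End IdealTheory.

(** * The canonical map into a localization *)

Section LocMap.
Variables (S : semidomainType) (T : multSet S).
Local Notation L := (localization T).
Local Notation f := (loc_map T).

Lemma loc_mapM a b : f (a * b) = f a * f b :> L.
Proof.
by apply/esym; rewrite [LHS]pi_mullf; apply: pi_loc_eq1; rewrite ?locfracE; ring.
Qed.

Lemma loc_mapD a b : f (a + b) = f a + f b :> L.
Proof.
by apply/esym; rewrite [LHS]pi_addlf; apply: pi_loc_eq1; rewrite ?locfracE; ring.
Qed.

Lemma loc_map0 : f 0 = 0 :> L. Proof. by []. Qed.

Lemma loc_map1 : f 1 = 1 :> L. Proof. by []. Qed.

(** Elements of [T] are nonzero, hence can be cancelled in a semidomain. *)
Lemma loc_map_inj : injective f.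
Proof.
move=> a b /eqP/loc_piP[u Tu]; rewrite !locfracE !mulr1.
exact/(@sd_mulfI S)/(mset_neq0 Tu).
Qed.

Lemma loc_map_unit s : mset T s -> exists v : L, v * f s = 1.
Proof.
move=> Ts; exists (fracc 1 Ts); rewrite [LHS]pi_mullf.
by apply: pi_loc_eq1; rewrite ?locfracE; ring.
Qed.

(** Replaces representatives of the quotient by an equation inside the localization; later arguments
    on fractions start from it. *)
Lemma loc_fracP (x : L) : exists a, exists2 s, mset T s & f s * x = f a.
Proof.
have [y ->] : exists y, x = \pi_(localization T)%qT y.
  by exists (generic_quotient.repr x); rewrite generic_quotient.reprK.
exists y.1, (den y); first exact: denP.
by rewrite [LHS]pi_mullf; apply: pi_loc_eq1; rewrite ?locfracE; ring.
Qed.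

End LocMap.

(** * The localization at a maximal ideal is local *)

Section LocalRing.
Variables (S : semidomainType) (m : set S) (hm : is_maximal_ideal m).
Let T := prime_compl (maximal_ideal_prime hm).
Local Notation L := (localization_at (maximal_ideal_prime hm)).
Local Notation f := (loc_map T : S -> L).

(** The extension of [m]: the fractions [a / s], given as solutions of [f s * x = f a]. *)
Definition loc_max : set L :=
  [set x | exists a s, [/\ m a, ~ m s & f s * x = f a]].

(** A fraction whose numerator lies outside [m] is a unit, so no proper ideal contains it. *)
Lemma proper_sub_loc_max (J : set L) : is_proper_ideal J -> J `<=` loc_max.
Proof.
move=> pJ x Jx; have [a [s Ts e]] := loc_fracP x.
exists a, s; split=> //; apply: contrapT => Ta.
have [v va] := loc_map_unit (T := T) Ta.
apply: (proper_ideal1 pJ); have [[_ _ JM] _] := pJ.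
have <- : v * f s * x = 1 by rewrite -mulrA e.
exact: JM.
Qed.

Lemma loc_max_proper : is_proper_ideal loc_max.
Proof.
have [[hI _] mP] := maximal_ideal_prime hm; have [_ ID IM] := hI.
have nM s t : ~ m s -> ~ m t -> ~ m (s * t) by move=> ns nt /mP[].
have n1 : ~ m 1 by apply: proper_ideal1; case: hm.
split; first split.
- by exists 0, 0, 1; split; [exact: ideal0|by []|rewrite mulr0].
- move=> x y [a [s [ma ns ex]]] [b [t [mb nt ey]]].
  exists (t * a + s * b), (s * t); split; [exact: ID (IM _ _ _) (IM _ _ _)|exact: nM|].
  rewrite loc_mapD !loc_mapM -ex -ey; ring.
- move=> y x [a [s [ma ns ex]]]; have [b [t nt ey]] := loc_fracP y.
  exists (b * a), (t * s); split; [exact: IM|exact: nM|].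
  rewrite !loc_mapM -ex -ey; ring.
- move=> MT; have [a [s [ma ns]]] : loc_max 1 by rewrite MT.
  by rewrite mulr1 => /loc_map_inj es; apply: ns; rewrite es.
Qed.

(** A proper ideal containing all proper ideals is maximal, and is the only maximal one. *)
Lemma localization_local : exists! M : set L, is_maximal_ideal M.
Proof.
exists loc_max; split.
  split; first exact: loc_max_proper.
  by move=> J pJ ?; apply/seteqP; split=> //; exact: proper_sub_loc_max.
move=> M [pM maxM]; apply: maxM; first exact: loc_max_proper.
exact: proper_sub_loc_max.
Qed.

End LocalRing.

(** * Fractional ideals, and the consequences of invertibility *)

Section Fractions.
Variable S : semidomainType.
Local Notation K := (semifield_of_fractions S).
Local Notation f := (@to_frac S).
Implicit Types A B : set K.

Lemma fracM a b : f (a * b) = f a * f b. Proof. exact: loc_mapM. Qed.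
Lemma fracD a b : f (a + b) = f a + f b. Proof. exact: loc_mapD. Qed.
Lemma frac0 : f 0 = 0. Proof. exact: loc_map0. Qed.
Lemma frac1 : f 1 = 1. Proof. exact: loc_map1. Qed.
Lemma frac_inj : injective f. Proof. exact: loc_map_inj. Qed.

Lemma frac_sum n (F : 'I_n -> S) : f (\sum_(i < n) F i) = \sum_(i < n) f (F i).
Proof. exact: (big_morph f fracD frac0). Qed.

Lemma frac_neq0 a : a != 0 -> f a != 0.
Proof. by apply: contra_neq => fa0; apply: frac_inj; rewrite frac0. Qed.

Lemma frac_unit a : a != 0 -> exists v, v * f a = 1.
Proof. by move=> a0; apply: loc_map_unit; apply/eqP. Qed.

Lemma frac_repr (x : K) : exists a, exists2 s, s != 0 & f s * x = f a.
Proof. by have [a [s /eqP s0 e]] := loc_fracP x; exists a, s. Qed.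

Lemma range_frac_sum n (F : 'I_n -> K) :
  (forall i, range f (F i)) -> range f (\sum_(i < n) F i).
Proof.
move=> FS; elim/big_ind: _ => //.
by move=> _ _ [a _ <-] [b _ <-]; exists (a + b) => //; exact: fracD.
Qed.

Lemma image_ideal_fractional (I : set S) :
  is_ideal I -> fractional_ideal (f @` I).
Proof.
move=> hI; have [_ ID IM] := hI; split.
- by exists (f 0), 0 => //; exact: ideal0.
- by move=> _ _ [a Ia <-] [b Ib <-]; exists (a + b); rewrite ?fracD //; exact: ID.
- by move=> s _ [a Ia <-]; exists (s * a); rewrite ?fracM //; exact: IM.
- exists 1; first exact: oner_neq0.
  by move=> _ [a _ <-]; exists a => //; rewrite frac1 mul1r.
Qed.

(** Invertibility expressed inside [S]: if [1] is the sum of the [a i * b i] with [b i] in the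
    inverse of [I], then [s i] is [a i * b i] and [y] is [x * b i]. *)
Lemma dedekind_decomp (I : set S) a0 : dedekind S -> is_ideal I ->
  I a0 -> a0 != 0 ->
  exists n (a s : 'I_n -> S), [/\ forall i, I (a i), \sum_(i < n) s i = 1 &
    forall i x, I x -> exists y, s i * x = y * a i].
Proof.
move=> dS hI Ia0 a00.
have [|B _ AB] := dS _ (image_ideal_fractional hI).
  move=> A0; have : (f @` I) (f a0) by exists a0.
  by rewrite A0 => /eqP; apply/negP/frac_neq0.
have [n [a [b [aI bB e]]]] : frac_mul (f @` I) B 1.
  by rewrite AB; exists 1; rewrite ?frac1.
have IB x i : I x -> exists y, f x * b i = f y.
  move=> Ix; have : frac_mul (f @` I) B (f x * b i).
    by exists 1%N, (fun=> f x), (fun=> b i); rewrite big_ord1; split.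
  by rewrite AB => -[y _ <-]; exists y.
have /choice[c cP] i : exists c, I c /\ f c = a i.
  by have [c Ic e'] := aI i; exists c.
have /choice[s sP] i : exists s, f (c i) * b i = f s.
  by apply: IB; case: (cP i).
exists n, c, s; split.
- by move=> i; case: (cP i).
- apply: frac_inj; rewrite frac_sum frac1 e.
  by apply: eq_bigr => i _; rewrite -sP; case: (cP i) => _ ->.
- move=> i x Ix; have [y ey] := IB x i Ix; exists y.
  by apply: frac_inj; rewrite !fracM -sP -ey; ring.
Qed.

Lemma dedekind_noetherian : dedekind S -> noetherian S.
Proof.
move=> dS I hI; have [_ ID IM] := hI.
(* The zero ideal is not invertible and is treated apart. *)
have [[a0 Ia0 a00]|I0] := pselect (exists2 a, I a & a != 0); last first.
  exists [set 0]; first exact: finite_set1.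
  apply: principal_gen => //; first exact: ideal0.
  move=> x Ix; exists 0; rewrite mulr0; apply/eqP; apply: contrapT => /negP x0.
  by apply: I0; exists x.
have [n [a [s [aI s1 sP]]]] := dedekind_decomp dS hI Ia0 a00.
exists (range a); first exact: finite_image.
apply/seteqP; split=> x; last by apply; split=> // _ [i _ <-].
(* [x] is the sum of the [s i * x], each a multiple of [a i]. *)
move=> Ix J [hJ aJ]; rewrite -(mul1r x) -s1 mulr_suml.
apply: ideal_sum => // i; have [y ->] := sP i x Ix.
by have [_ _ JM] := hJ; apply: JM; apply: aJ; exists i.
Qed.

(* As the [s i] sum to 1, some [s i] lies outside [m] and is a unit of the
   localization, where [a i] then generates the whole ideal. *)
Lemma dedekind_local_pisd (m : set S) (hm : is_maximal_ideal m) :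
  dedekind S -> pisd (localization_at (maximal_ideal_prime hm)).
Proof.
move=> dS J hJ; have [_ JD JM] := hJ.
set T := prime_compl (maximal_ideal_prime hm).
pose g : S -> localization_at (maximal_ideal_prime hm) := loc_map T.
(* The contraction of [J] to [S]; by [Jfrac] below, every element of [J] is a multiple of the image
   of an element of [I]. *)
pose I := [set a | J (g a)].
have hI : is_ideal I.
  split.
  - by exists 0; exact: (ideal0 hJ).
  - by move=> a b Ja Jb; rewrite /I /= /g loc_mapD; exact: JD.
  - by move=> s a Ja; rewrite /I /= /g loc_mapM; exact: JM.
have Jfrac x : J x -> exists a v, [/\ I a, x = v * g a & x != 0 -> a != 0].
  move=> Jx; have [a [s Ts e]] := loc_fracP x.
  have [v vs] := loc_map_unit Ts.
  have xE : x = v * g a by rewrite /g -e mulrA vs mul1r.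
  exists a, v; split=> //; first by rewrite /I /= /g -e; exact: JM.
  by apply: contra_neq => a0; rewrite xE a0 /g loc_map0 mulr0.
have [[x Jx x0]|J0] := pselect (exists2 x, J x & x != 0); last first.
  exists 0; apply: principal_gen => //; first exact: (ideal0 hJ).
  move=> x Jx; exists 0; rewrite mulr0; apply/eqP; apply: contrapT => /negP x0.
  by apply: J0; exists x.
have [a0 [_ [Ia0 _ /(_ x0) a00]]] := Jfrac x Jx.
have [n [a [s [aI s1 sP]]]] := dedekind_decomp dS hI Ia0 a00.
have [i nsi] : exists i, ~ m (s i).
  apply: contrapT => /forallNP sm.
  have [pm _] := hm; have [idm _] := pm; apply: (proper_ideal1 pm).
  by rewrite -s1; apply: ideal_sum => // i; exact: contrapT (sm i).
have [w ws] := loc_map_unit (T := T) nsi.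
exists (g (a i)); apply: principal_gen => //; first exact: aI.
move=> z /Jfrac[b [v [Ib -> _]]]; have [y ey] := sP i b Ib.
(* Since [w] inverts [g (s i)], the relation [s i * b = y * a i] solves for [g b]. *)
exists (v * w * g y); rewrite -!mulrA -[g y * g _]loc_mapM -ey.
by rewrite loc_mapM [w * _]mulrA ws mul1r.
Qed.

(** * The colon [(S : A)], the only possible inverse of [A], and the local test that it is one *)

Definition frac_inv A : set K := [set x | forall a, A a -> range f (a * x)].

Lemma frac_mulD A B x y :
  frac_mul A B x -> frac_mul A B y -> frac_mul A B (x + y).
Proof.
move=> [n [a [b [aA bB ->]]]] [k [c [d [cA dB ->]]]].
exists (n + k)%N, (fun i => match split i with inl j => a j | inr j => c j end),
  (fun i => match split i with inl j => b j | inr j => d j end); split.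
- by move=> i; case: split.
- by move=> i; case: split.
rewrite big_split_ord /=; congr (_ + _); apply: eq_bigr => i _.
  by rewrite (unsplitK (inl i)).
by rewrite (unsplitK (inr i)).
Qed.

(** Pulls a product back to [S], where it can be compared with maximal ideals. *)
Lemma frac_mul_ideal A B : fractional_ideal A -> B !=set0 ->
  is_ideal [set s | frac_mul A B (f s)].
Proof.
move=> [[a Aa] _ AM _] [b Bb]; split.
- exists 0; rewrite /= frac0; exists 0%N, (fun=> a), (fun=> b).
  by rewrite big_ord0.
- by move=> s t; rewrite /= fracD; exact: frac_mulD.
- move=> s t /= [n [c [d [cA dB e]]]]; rewrite fracM e mulr_sumr.
  exists n, (fun i => f s * c i), d; split=> //; first by move=> i; exact: AM.
  by apply: eq_bigr => i _; rewrite mulrA.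
Qed.

(** The numerator of a nonzero element of [A] is its multiple by the denominator, so it stays in
    [A]. *)
Lemma fractional_integral_elt A : fractional_ideal A -> A <> [set 0] ->
  exists2 p, p != 0 & A (f p).
Proof.
move=> [[x0 Ax0] _ AM _] A0.
have [x Ax xn0] : exists2 x, A x & x != 0.
  apply: contrapT => nA; apply: A0.
  have Az x : A x -> x = 0.
    by move=> Ax; apply/eqP; apply: contrapT => /negP xn0; apply: nA; exists x.
  apply/seteqP; split=> [x /Az //|_ ->].
  by rewrite -(Az _ Ax0).
have [p [q q0 e]] := frac_repr x.
exists p; last by rewrite -e; exact: AM.
apply/eqP => p0; move: e; rewrite p0 frac0 => /eqP; apply/negP.
exact: sd_mulf_neq0 (frac_neq0 q0) xn0.
Qed.

(** A common denominator of [A] lies in the inverse, and a nonzero element of [S] in [A] is a common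
    denominator of the inverse. *)
Lemma frac_inv_fractional A : fractional_ideal A -> A <> [set 0] ->
  fractional_ideal (frac_inv A).
Proof.
move=> fA A0; have [p p0 Ap] := fractional_integral_elt fA A0.
have [_ _ _ [d _ dA]] := fA; split.
- by exists (f d) => a /dA; rewrite mulrC.
- move=> x y hx hy a Aa; have [[s _ es] [t _ et]] := (hx a Aa, hy a Aa).
  by exists (s + t); rewrite // fracD es et mulrDr.
- move=> r x hx a Aa; have [s _ es] := hx a Aa.
  by exists (r * s); rewrite // fracM es mulrCA.
- by exists p => // x; exact.
Qed.

(* Over the localization at [m], [d A] becomes principal, generated by some
   [a] of [d A]; finite generation yields [t] outside [m] with [t d A] inside
   [a S].  Then [t d / a] lies in the inverse of [A], and [a / d] in [A]. *)
Lemma frac_inv_not_in_maximal A (m : set S) (hm : is_maximal_ideal m) :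
  noetherian S -> pisd (localization_at (maximal_ideal_prime hm)) ->
  fractional_ideal A -> A <> [set 0] ->
  exists2 t, ~ m t & frac_mul A (frac_inv A) (f t).
Proof.
move=> nS pS fA A0; have [p p0 Ap] := fractional_integral_elt fA A0.
have [_ AD AM [d d0 dA]] := fA.
set T := prime_compl (maximal_ideal_prime hm).
pose g : S -> localization_at (maximal_ideal_prime hm) := loc_map T.
pose I := [set s | exists2 x, A x & f s = f d * x].
have hI : is_ideal I.
  split.
  - by exists (d * p), (f p); rewrite ?fracM.
  - move=> s t [x Ax ex] [y Ay ey]; exists (x + y); first exact: AD.
    by rewrite fracD ex ey mulrDr.
  - move=> r s [x Ax ex]; exists (f r * x); first exact: AM.
    by rewrite fracM ex mulrCA.
have [G finG IE] := nS I hI; have [_ ID IM] := hI.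
pose J := [set x | exists i v, I i /\ x = v * g i].
have hJ : is_ideal J.
  (* Elements of [J], the extension of [I], are also fractions [i / s]; common denominators then
     give closure under addition. *)
  have JP x : J x <-> exists i s, [/\ I i, ~ m s & g s * x = g i].
    split=> [[i [v [Ii ->]]]|[i [s [Ii ns e]]]].
      have [c [s ns e]] := loc_fracP v; exists (c * i), s; split=> //.
        exact: IM.
      by rewrite /g loc_mapM -e mulrA.
    have [v vs] := loc_map_unit (T := T) ns; exists i, v; split=> //.
    by rewrite -e mulrA vs mul1r.
  have nM s t : ~ m s -> ~ m t -> ~ m (s * t) by exact: (@msetM _ T).
  split.
  - by exists (0 * g 0), 0, 0; split => //; exact: ideal0.
  - move=> x y /JP[i [s [Ii ns ex]]] /JP[j [t [Ij nt ey]]]; apply/JP.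
    exists (t * i + s * j), (s * t); split; [by apply: ID; exact: IM|exact: nM|].
    by rewrite /g loc_mapD !loc_mapM -/g -/(g _) -/(g _) -ex -ey; ring.
  - by move=> y x [i [v [Ii ->]]]; exists i, (y * v); rewrite mulrA.
have [z Jz] := pS J hJ.
(* The generator [z] is a multiple of [g a], which lies in [J], so [g a] generates [J] too. *)
have [a [v [Ia zE]]] : J z by rewrite Jz => H [_]; exact.
have Iloc s : I s -> exists2 t, ~ m t & exists r, t * s = r * a.
  move=> Is; have : J (g s) by exists s, 1; rewrite mul1r.
  rewrite Jz => /ideal_gen1P[w e].
  have [c [t nt et]] := loc_fracP (w * v); exists t => //; exists c.
  by apply: (@loc_map_inj _ T); rewrite !loc_mapM -et -!mulrA -[v * _]zE -e.
have [t nt tI] : exists2 t, mset T t & I `<=` [set x | exists r, t * x = r * a].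
  rewrite IE; apply: (common_multiplier (I := [set x | exists r, x = r * a])).
  - exact: principal_ideal.
  - exact: finG.
  - by move=> x Gx; apply: Iloc; rewrite IE => H [_]; exact.
have a0 : a != 0.
  apply/eqP => a0.
  have [r /eqP] : exists r, t * (d * p) = r * a.
    by apply: tI; exists (f p) => //; rewrite fracM.
  rewrite a0 mulr0; apply/negP; rewrite !sd_mulf_neq0 //.
  exact: (mset_neq0 nt).
have [b ba] := frac_unit a0; have [x Ax ex] := Ia.
exists t; first exact: nt.
exists 1%N, (fun=> x), (fun=> f t * f d * b); rewrite big_ord1; split=> //.
  move=> _ y Ay; have [s _ es] := dA y Ay.
  have [r er] : exists r, t * s = r * a by apply: tI; exists y.
  exists r => //; transitivity (b * f (r * a)).
    by rewrite fracM mulrCA ba mulr1.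
  by rewrite -er fracM es; ring.
by rewrite -[LHS]mulr1 -ba ex; ring.
Qed.

Lemma local_pisd_dedekind : noetherian S ->
  (forall (m : set S) (hm : is_maximal_ideal m),
    pisd (localization_at (maximal_ideal_prime hm))) ->
  dedekind S.
Proof.
move=> nS pS A fA A0; exists (frac_inv A); first exact: frac_inv_fractional.
have fB := frac_inv_fractional fA A0.
apply/seteqP; split=> [_ [n [a [b [aA bB ->]]]]|].
  by apply: range_frac_sum => i; exact: bB.
pose P := [set s | frac_mul A (frac_inv A) (f s)].
have hP : is_ideal P by apply: frac_mul_ideal => //; case: fB.
suff PT : P = setT.
  by move=> _ [s _ <-]; have : P s by rewrite PT.
(* A proper [P] would lie in some maximal [m], yet it has an element outside [m]. *)
apply: contrapT => nPT.
have [m hm Pm] := maximal_ideal_above (conj hP nPT).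
by have [t nt /Pm] := frac_inv_not_in_maximal nS (pS m hm) fA A0.
Qed.

End Fractions.

Theorem theorem3p7 (S : semidomainType) :
  dedekind S <->
  (noetherian S /\
   forall (m : set S) (hm : is_maximal_ideal m),
     dvs (localization_at (maximal_ideal_prime hm))).
Proof.
split=> [dS|[nS lS]].
  split; first exact: dedekind_noetherian.
  move=> m hm; split; first exact: dedekind_local_pisd.
  exact: localization_local.
by apply: local_pisd_dedekind => // m hm; case: (lS m hm).
Qed.
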